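(* Let $k$ and $c$ be such that $1\le c\le\frac{10k}{22}$, let $\epsilon=1/\log_{2.2}(k/c)$, and consider the graph $G^{(o)}_{k,c}$ described in the context. Then $\phi(T)\ge\frac12$ for every nonempty $T\subset V$ with $|T|<\frac{c}{k}|V|$.
   Context: $G^{(o)}_{k,c}$ has vertex set $V=\{0,1\}^k$; $x,y$ are adjacent iff $\|x-y\|_1$ (the number of coordinates in which they differ) is odd, with edge weight $\epsilon^{\|x-y\|_1}$. For $X,Y\subseteq V$, $w(X,Y)$ is the sum of weights of edges with one endpoint in $X$ and the other in $Y$ (edges with both endpoints in $X\cap Y$ counted twice). The conductance of $T$ is $\phi(T)=\dfrac{w(T,V\setminus T)}{w(T,V)}$. *)

(* Defs.v *)
From mathcomp Require Import all_boot all_order all_algebra.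
From mathcomp Require Import reals exp.

Set Implicit Arguments.
Unset Strict Implicit.
Unset Printing Implicit Defensive.

Import Order.TTheory GRing.Theory Num.Theory.
Local Open Scope ring_scope.

(* w(X, Y) for a finite weighted graph with symmetric adjacency [e] and edge
   weights [wt]: the sum runs over ordered pairs, so that an edge with both
   endpoints in X :&: Y is counted twice and any other edge at most once. *)
Definition edge_weight (R : realType) (V : finType) (e : rel V)
    (wt : V -> V -> R) (X Y : {set V}) : R :=
  \sum_(x in X) \sum_(y in Y | e x y) wt x y.

Definition conductance (R : realType) (V : finType) (e : rel V)
    (wt : V -> V -> R) (T : {set V}) : R :=
  edge_weight e wt T (~: T) / edge_weight e wt T [set: V].

Notation cube k := {ffun 'I_k -> bool}.

Definition hamming (k : nat) (x y : cube k) : nat := #|[set i | x i != y i]|.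

Definition odd_adj (k : nat) : rel (cube k) := fun x y => odd (hamming x y).

Definition logb (R : realType) (b x : R) : R := ln x / ln b.

Definition noise (R : realType) (k : nat) (c : R) : R :=
  1 / logb (22%:R / 10%:R) (k%:R / c).

Definition odd_weight (R : realType) (k : nat) (c : R) (x y : cube k) : R :=
  noise k c ^+ hamming x y.

Definition odd_conductance (R : realType) (k : nat) (c : R)
    (T : {set cube k}) : R :=
  conductance (@odd_adj k) (@odd_weight R k c) T.

(* Main.v *)
(* With e the noise and A_t(x, y) = t^|x - y|, the graph has adjacency matrix
   (A_e - A_(-e)) / 2 and degree d = ((1 + e)^k - (1 - e)^k) / 2.
   Comparing eigenvalues, (1 - e)^k A_e <= (1 + e)^k A_(-e) as quadratic forms,
   so w(T, T) / d <= <1_T, A_e 1_T> / (1 + e)^k.  Hypercontractivity bounds the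
   right-hand side by |T| (|T| / 2^k)^e; on indicators it follows by induction
   on k from Cauchy-Schwarz and the Bonami two-point inequality.  Finally
   (|T| / 2^k)^e < (c / k)^e = 1 / 2.2 < 1 / 2. *)

Require Import Defs.
From mathcomp Require Import all_boot all_order all_algebra.
From mathcomp Require Import boolp normedtype sequences derive realfun reals exp.
From mathcomp Require Import ring lra.

Set Implicit Arguments.
Unset Strict Implicit.

Import Order.TTheory GRing.Theory Num.Theory numFieldNormedType.Exports.
Local Open Scope ring_scope.

(** * Elementary inequalities for real powers *)

(** Bernoulli's inequality. The bound [expR u >= 1 + u], scaled by [y ^ a], is applied at
    [(1 - a) * L] and [- (a * L)]; weighting the two by [a] and [1 - a] cancels the terms in [L]. *)
Lemma powR_le_affine (R : realType) (a y : R) :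
  0 <= a <= 1 -> 0 < y -> y `^ a <= 1 + a * (y - 1).
Proof.
move=> /andP[a0 a1] y0; rewrite /powR gt_eqF//.
set L := ln y; have yE : y = expR L by rewrite lnK.
have E0 := expR_gt0 (a * L).
have h1 := expR_ge1Dx ((1 - a) * L); have h2 := expR_ge1Dx (- (a * L)).
have e1 : y = expR (a * L) * expR ((1 - a) * L).
  by rewrite -expRD yE; congr expR; ring.
have e2 : 1 = expR (a * L) * expR (- (a * L)) by rewrite expRN divff ?gt_eqF.
have i1 : expR (a * L) * (1 + (1 - a) * L) <= y by rewrite [leRHS]e1 ler_pM2l.
have i2 : expR (a * L) * (1 + - (a * L)) <= 1 by rewrite [leRHS]e2 ler_pM2l.
have j1 := ler_wpM2l a0 i1.
have a1' : 0 <= 1 - a by lra.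
have j2 := ler_wpM2l a1' i2.
move: (expR _) E0 j1 j2 => z *; nra.
Qed.

Lemma derive_ge0_le_unit (R : realType) (f df : R -> R) (t : R) :
  (forall x : R, 0 <= x < 1 -> is_derive x 1 f (df x)) ->
  (forall x : R, 0 <= x < 1 -> 0 <= df x) ->
  0 <= t < 1 -> f 0 <= f t.
Proof.
move=> fD df0 /andP[t0 t1].
have in01 x : x \in `[0, t] -> 0 <= x < 1.
  by rewrite in_itv /= => /andP[-> /le_lt_trans ->].
have [x||x xt E] := @MVT_segment R f df 0 t t0.
- by move=> xt; apply/fD/in01; apply: subset_itv_oo_cc xt.
- by apply: derivable_within_continuous => x /in01 /fD[].
- rewrite -subr_ge0 E mulr_ge0 ?subr0 //; exact/df0/in01.
Qed.

Lemma is_derive_powR1D (R : realType) (q s x : R) :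
  0 < 1 + s * x ->
  is_derive x 1 (fun y => (1 + s * y) `^ q) (s * (q * (1 + s * x) `^ (q - 1))).
Proof.
move=> h.
have H := @is_derive1_comp R (fun u : R => u `^ q) (fun y => 1 + s * y) x _ s (is_derive1_powR q h).
rewrite mulrC; apply: H.
apply: is_derive_eq.
by rewrite add0r mul1r /GRing.scale /= mulr1.
Qed.

(** For [q = p - 1] this is the derivative, up to the factor [p], of the next inequality. *)
Lemma powR_diff_ge_linear (R : realType) (q t : R) :
  0 <= q <= 1 -> 0 <= t < 1 ->
  2%:R * q * t <= (1 + t) `^ q - (1 - t) `^ q.
Proof.
move=> /andP[q0 q1] t01.
(* The factors 1 and -1 make both powers instances of [is_derive_powR1D]. *)
pose f (x : R) := (1 + 1 * x) `^ q - (1 + -1 * x) `^ q - (2%:R * q) * x.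
pose df (x : R) := 1 * (q * (1 + 1 * x) `^ (q - 1))
  - (-1) * (q * (1 + -1 * x) `^ (q - 1)) - 2%:R * q.
suff : f 0 <= f t by rewrite /f !mulr0 !addr0 powR1 subrr !mul1r !mulN1r; lra.
apply: (@derive_ge0_le_unit _ _ df) => // x /andP[x0 x1].
- have p1 : 0 < 1 + 1 * x by lra.
  have p2 : 0 < 1 + -1 * x by lra.
  have D1 := @is_derive_powR1D R q 1 x p1.
  have D2 := @is_derive_powR1D R q (-1) x p2.
  apply: is_derive_eq.
  by rewrite /df /GRing.scale /= mulr1.
- have p1 : 0 < 1 + 1 * x by lra.
  have p2 : 0 < 1 + -1 * x by lra.
  pose h := (1 - q) / 2%:R.
  have h0 : 0 <= h by rewrite /h; lra.
  have qE : q - 1 = - h + - h by rewrite /h; field.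
  (* AM-GM: the mean of (1+x)^(q-1) and (1-x)^(q-1) is at least (1-x^2)^((q-1)/2) >= 1. *)
  have E (a : R) : 0 < a -> a `^ (q - 1) = a `^ (- h) * a `^ (- h).
    by move=> a0; rewrite qE powRD// (gt_eqF a0) implybT.
  have P : 1 <= (1 + 1 * x) `^ (- h) * (1 + -1 * x) `^ (- h).
    rewrite -powRM ?(ltW p1) ?(ltW p2)// powRN invf_ge1 ?powR_gt0 ?mulr_gt0//.
    have one : 1 = 1 `^ h :> R by rewrite powR1.
    rewrite [leRHS]one.
    by apply: ge0_ler_powR; rewrite ?nnegrE ?mulr_ge0 ?(ltW p1) ?(ltW p2)//; nra.
  rewrite /df !E//.
  move: (_ `^ _) (_ `^ _) P => u v P.
  have uv : 0 <= (u - v) * (u - v) by exact: sqr_ge0.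
  have : 0 <= q * (u * u + v * v - 2%:R) by apply: mulr_ge0 => //; lra.
  lra.
Qed.

Lemma powR_mean_ge_quadratic (R : realType) (p t : R) :
  1 <= p <= 2%:R -> 0 <= t < 1 ->
  1 + p * (p - 1) / 2%:R * t ^+ 2 <= ((1 + t) `^ p + (1 - t) `^ p) / 2%:R.
Proof.
move=> /andP[p1 p2] t01.
pose f (x : R) := (1 + 1 * x) `^ p + (1 + -1 * x) `^ p - (p * (p - 1)) * (x * x).
pose df (x : R) := 1 * (p * (1 + 1 * x) `^ (p - 1))
  + (-1) * (p * (1 + -1 * x) `^ (p - 1)) - (p * (p - 1)) * (x + x).
suff : f 0 <= f t by rewrite /f !mulr0 !addr0 powR1 !mul1r !mulN1r expr2; lra.
apply: (@derive_ge0_le_unit _ _ df) => // x /andP[x0 x1].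
- have q1 : 0 < 1 + 1 * x by lra.
  have q2 : 0 < 1 + -1 * x by lra.
  have D1 := @is_derive_powR1D R p 1 x q1.
  have D2 := @is_derive_powR1D R p (-1) x q2.
  apply: is_derive_eq.
  by rewrite /df /GRing.scale /= !mulr1.
- have := @powR_diff_ge_linear R (p - 1) x.
  rewrite /df !mul1r !mulN1r => H.
  have {}H : 2%:R * (p - 1) * x <= (1 + x) `^ (p - 1) - (1 - x) `^ (p - 1).
    by apply: H; apply/andP; split; lra.
  move: H; set u := (1 + x) `^ _; set v := (1 - x) `^ _ => H.
  have : 0 <= p * (u - v - 2%:R * (p - 1) * x) by apply: mulr_ge0; lra.
  lra.
Qed.

(** * Bonami's two-point inequality *)

(** Bonami's inequality for the values 1 + t and 1 - t, with exponent p = 2 / (1 + e) and squared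
    correlation p - 1 = (1 - e) / (1 + e). After taking (1 + e)-th roots, Bernoulli bounds the left
    side by 1 + (1 - e) / (1 + e)^2 t^2, whose coefficient is exactly the p (p - 1) / 2 of the
    quadratic lower bound. *)
Lemma two_point_centered (R : realType) (e t : R) :
  0 < e <= 1 -> 0 <= t < 1 ->
  1 + (1 - e) / (1 + e) * t ^+ 2 <=
    (((1 + t) `^ (2%:R / (1 + e)) + (1 - t) `^ (2%:R / (1 + e))) / 2%:R)
      `^ (1 + e).
Proof.
set p := 2%:R / (1 + e).
move=> /andP[e0 e1] t01; have /andP[t0 t1] := t01.
have d0 : 0 < 1 + e by lra.
set y := (X in X <= _).
have y1 : 1 <= y.
  by rewrite lerDl mulr_ge0 ?sqr_ge0 // divr_ge0 ?subr_ge0 // ltW.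
have y0 : 0 < y by lra.
have yE : y = (y `^ (1 + e)^-1) `^ (1 + e).
  by rewrite -powRrM mulVf ?gt_eqF // powRr1 // ltW.
have i01 : 0 <= (1 + e)^-1 <= 1.
  by rewrite invr_ge0 ltW //= invf_le1 // lerDl ltW.
have p12 : 1 <= p <= 2%:R.
  by rewrite /p ler_pdivlMr // ler_pdivrMr //; apply/andP; split; lra.
rewrite [leLHS]yE; apply: ge0_ler_powR; rewrite ?nnegrE ?powR_ge0 ?(ltW d0) //.
  by rewrite divr_ge0 // addr_ge0 ?powR_ge0.
apply: le_trans (powR_le_affine i01 y0) _.
apply: le_trans (powR_mean_ge_quadratic p12 t01).
rewrite le_eqVlt; apply/orP; left; apply/eqP; rewrite /y /p.
by field; rewrite gt_eqF.
Qed.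

Lemma two_point_pos (R : realType) (e A B : R) :
  0 < e <= 1 -> 0 < B -> B <= A ->
  A ^+ 2 + B ^+ 2 + 2%:R * e * (A * B) <=
    (1 + e) / 2%:R `^ e *
      (A `^ (2%:R / (1 + e)) + B `^ (2%:R / (1 + e))) `^ (1 + e).
Proof.
set p := 2%:R / (1 + e) => e01 B0 BA; have /andP[e0 e1] := e01.
have d0 : 0 < 1 + e by lra.
(* Both sides are homogeneous of degree 2, so the mean [m] factors out; [B > 0] gives [t < 1]. *)
pose m := (A + B) / 2%:R; pose t := (A - B) / (A + B).
have AB0 : 0 < A + B by lra.
have m0 : 0 < m by rewrite /m; lra.
have AE : A = m * (1 + t) by rewrite /m /t; field; rewrite gt_eqF.
have BE : B = m * (1 - t) by rewrite /m /t; field; rewrite gt_eqF.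
have t01 : 0 <= t < 1.
  by rewrite /t divr_ge0 ?subr_ge0 ?(ltW AB0) //= ltr_pdivrMr //; lra.
have /andP[t0 t1] := t01.
move: m t m0 AE BE t01 t0 t1 => m t m0 AE BE t01 t0 t1.
have := two_point_centered e01 t01.
rewrite /= -/p => H.
have -> : A ^+ 2 + B ^+ 2 + 2%:R * e * (A * B) =
    2%:R * m ^+ 2 * (1 + e) * (1 + (1 - e) / (1 + e) * t ^+ 2).
  by rewrite AE BE; field; rewrite gt_eqF.
have -> : A `^ p + B `^ p =
    m `^ p * 2%:R * (((1 + t) `^ p + (1 - t) `^ p) / 2%:R).
  have t0' : 0 <= 1 + t by lra.
  have t1' : 0 <= 1 - t by lra.
  by rewrite {1}AE {1}BE !powRM ?(ltW m0) //; field.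
have S0 : 0 <= ((1 + t) `^ p + (1 - t) `^ p) / 2%:R.
  by rewrite divr_ge0 // addr_ge0 ?powR_ge0.
move: (((1 + t) `^ p + _) / _) S0 H => S S0 H.
rewrite !powRM ?mulr_ge0 ?powR_ge0 //.
have -> : (m `^ p) `^ (1 + e) = m ^+ 2.
  rewrite -powRrM /p divfK ?gt_eqF //.
  by rewrite powR_mulrn // ltW.
have -> : 2%:R `^ (1 + e) = 2%:R * 2%:R `^ e :> R.
  by rewrite powRD ?powRr1 // pnatr_eq0 implybT.
have -> : (1 + e) / 2%:R `^ e * (m ^+ 2 * (2%:R * 2%:R `^ e) * S `^ (1 + e)) =
    2%:R * m ^+ 2 * (1 + e) * S `^ (1 + e).
  by field; rewrite gt_eqF // powR_gt0.
by rewrite ler_wpM2l // !mulr_ge0 //; nra.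
Qed.

Lemma two_point_ineq (R : realType) (e a b : R) :
  0 < e <= 1 -> 0 <= a -> 0 <= b ->
  (a `^ ((1 + e) / 2%:R)) ^+ 2 + (b `^ ((1 + e) / 2%:R)) ^+ 2 +
    2%:R * e * (a `^ ((1 + e) / 2%:R) * b `^ ((1 + e) / 2%:R)) <=
    (1 + e) / 2%:R `^ e * (a + b) `^ (1 + e).
Proof.
set h := (1 + e) / 2%:R.
move=> e01; have /andP[e0 e1] := e01.
have h0 : 0 < h by rewrite /h; lra.
wlog ab : a b / b <= a => [W a0 b0|a0].
  have [ab|/ltW ba] := leP b a; first exact: W.
  by have := W b a ba b0 a0; rewrite (addrC b a) (mulrC (b `^ h)); lra.
(* For b = 0 the claim reduces to 2^e <= 1 + e, which is Bernoulli at y = 2. *)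
rewrite le_eqVlt => /predU1P[<-|b0].
  rewrite (powR0 (x := h)) ?gt_eqF // mulr0 mulr0 expr0n /= !addr0.
  have -> : (a `^ h) ^+ 2 = a `^ (1 + e).
    by rewrite -powR_mulrn ?powR_ge0 // -powRrM /h divfK // pnatr_eq0.
  rewrite -[leLHS]mul1r ler_wpM2r ?powR_ge0 //.
  rewrite ler_pdivlMr ?powR_gt0 // mul1r.
  have e01' : 0 <= e <= 1 by rewrite ltW.
  have := powR_le_affine e01' (ltr0n R 2); lra.
pose p := 2%:R / (1 + e).
have hp : h * p = 1 by rewrite /h /p; field; rewrite gt_eqF //; lra.
have {}a0 : 0 < a by lra.
have aE : a = (a `^ h) `^ p by rewrite -powRrM hp powRr1 // ltW.
have bE : b = (b `^ h) `^ p by rewrite -powRrM hp powRr1 // ltW.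
have BA : b `^ h <= a `^ h.
  by apply: ge0_ler_powR => //; rewrite ?nnegrE ltW.
rewrite [in a + b]aE [in _ + b]bE.
by apply: two_point_pos => //; rewrite powR_gt0.
Qed.

(** * The noise form and its recursion on the dimension *)

Definition cube_cons k (b : bool) (x : cube k) : cube k.+1 :=
  [ffun i => if unlift ord0 i is Some j then x j else b].

Lemma hamming_cons k b c (x y : cube k) :
  hamming (cube_cons b x) (cube_cons c y) = ((b != c) + hamming x y)%N.
Proof.
rewrite /hamming -!sum1_card !big_mkcond big_ord_recl /=.
rewrite !inE !ffunE unlift_none; congr (_ + _)%N.
rewrite [RHS]big_mkcond; apply: eq_bigr => i _; rewrite !inE !ffunE !liftK.
by case: (_ == _).
Qed.

Lemma sum_cube_recl (R : nmodType) k (F : cube k.+1 -> R) :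
  \sum_x F x = \sum_x F (cube_cons true x) + \sum_x F (cube_cons false x).
Proof.
pose h (p : bool * cube k) := cube_cons p.1 p.2.
pose g (x : cube k.+1) : bool * cube k := (x ord0, [ffun i => x (lift ord0 i)]).
rewrite (reindex h); last first.
  exists g => [[b x] _|x _]; rewrite /g /h /cube_cons /=.
    rewrite ffunE unlift_none; congr pair; apply/ffunP => i.
    by rewrite !ffunE liftK.
  by apply/ffunP => i; rewrite ffunE; case: unliftP => [j ->|->]; rewrite ?ffunE.
rewrite -(pair_bigA _ (fun b x => F (cube_cons b x))) /=.
by rewrite big_bool.
Qed.

(** The bilinear form of the k-th tensor power of the 2 by 2 matrix with 1 on the diagonal and t off
    it. Negative t is needed to isolate odd distances. *)
Definition noise_form (R : pzRingType) k (t : R) (f g : cube k -> R) : R :=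
  \sum_x \sum_y f x * g y * t ^+ hamming x y.

Section NoiseForm.
Variable R : comPzRingType.
Implicit Types t a b : R.

Lemma noise_formC k t (f g : cube k -> R) : noise_form t f g = noise_form t g f.
Proof.
rewrite /noise_form exchange_big /=; apply: eq_bigr => x _; apply: eq_bigr => y _.
rewrite mulrC [f y * _]mulrC mulrC; congr (_ * _ ^+ _).
by rewrite /hamming; apply: eq_card => i; rewrite !inE eq_sym.
Qed.

Lemma noise_form_linl k t a b (f f' g : cube k -> R) :
  noise_form t (fun x => a * f x + b * f' x) g =
  a * noise_form t f g + b * noise_form t f' g.
Proof.
rewrite /noise_form !mulr_sumr -big_split; apply: eq_bigr => x _ /=.
rewrite !mulr_sumr -big_split; apply: eq_bigr => y _ /=; ring.
Qed.

Lemma noise_form_diag k t a b (f g : cube k -> R) :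
  let h x := a * f x + b * g x in
  noise_form t h h = a ^+ 2 * noise_form t f f +
    2%:R * a * b * noise_form t f g + b ^+ 2 * noise_form t g g.
Proof.
move=> h; rewrite {1}/h noise_form_linl (noise_formC t f h) (noise_formC t g h).
rewrite !noise_form_linl (noise_formC t g f); ring.
Qed.

Lemma noise_form_cons k t (f g : cube k.+1 -> R) :
  let r (b : bool) (u : cube k.+1 -> R) x := u (cube_cons b x) in
  noise_form t f g =
    noise_form t (r true f) (r true g) + noise_form t (r false f) (r false g) +
    t * (noise_form t (r true f) (r false g) + noise_form t (r false f) (r true g)).
Proof.
move=> r.
have E (b c : bool) : \sum_x \sum_y f (cube_cons b x) * g (cube_cons c y) *
    t ^+ hamming (cube_cons b x) (cube_cons c y) =
    t ^+ (b != c) * noise_form t (r b f) (r c g).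
  rewrite mulr_sumr; apply: eq_bigr => x _; rewrite mulr_sumr.
  apply: eq_bigr => y _; rewrite hamming_cons exprD /r; ring.
rewrite {1}/noise_form sum_cube_recl.
under eq_bigr => x _ do rewrite sum_cube_recl.
under [X in _ + X = _]eq_bigr => x _ do rewrite sum_cube_recl.
rewrite !big_split /= !E /= expr0 expr1; ring.
Qed.

Lemma noise_form0n t (f g : cube 0 -> R) :
  noise_form t f g = f [ffun=> false] * g [ffun=> false].
Proof.
have E (x y : cube 0) : x = y by apply/ffunP => -[].
rewrite /noise_form (big_pred1 [ffun=> false]); last by move=> x; apply/esym/eqP.
rewrite (big_pred1 [ffun=> false]); last by move=> x; apply/esym/eqP.
by rewrite /hamming eq_card0 ?mulr1 // => -[].
Qed.

(** Constants are eigenvectors with eigenvalue (1 + t)^k; this yields the degree of the graph. *)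
Lemma noise_form_const1r k t (f : cube k -> R) :
  noise_form t f (fun=> 1) = (1 + t) ^+ k * \sum_x f x.
Proof.
elim: k f => [|k IH] f.
  rewrite noise_form0n expr0 mul1r mulr1 (big_pred1 [ffun=> false]) // => x.
  by apply/esym/eqP/ffunP => -[].
rewrite noise_form_cons /= !IH sum_cube_recl exprS; ring.
Qed.

End NoiseForm.

(** * Positivity and comparison of quadratic forms *)

Section RealNoiseForm.
Variable R : realFieldType.
Implicit Types e : R.

(** With q the form in dimension k, the form in dimension k + 1 is (1 - e) (q(f1) + q(f0)) + e q(f1
    + f0), a nonnegative combination. *)
Lemma noise_form_ge0 k e (f : cube k -> R) :
  0 <= e <= 1 -> 0 <= noise_form e f f.
Proof.
move=> /andP[e0 e1]; elim: k f => [|k IH] f; first by rewrite noise_form0n sqr_ge0.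
rewrite noise_form_cons /=.
set f1 := fun x => f (cube_cons true x); set f0 := fun x => f (cube_cons false x).
have := IH (fun x => 1 * f1 x + 1 * f0 x); rewrite noise_form_diag.
rewrite [noise_form e f0 f1]noise_formC.
move: (IH f1) (IH f0); move: (noise_form _ _ _) (noise_form _ _ _) (noise_form _ _ _).
move=> u v w; rewrite !expr1n; nra.
Qed.

(* The eigenvalue of [noise_form t] on a character of weight [s] is
   (1 + t)^(k - s) (1 - t)^s; the comparison below is eigenvalue by eigenvalue. *)
Lemma noise_formN_ge k e (f : cube k -> R) : 0 <= e <= 1 ->
  (1 - e) ^+ k * noise_form e f f <= (1 + e) ^+ k * noise_form (- e) f f.
Proof.
move=> e01; have /andP[e0 e1] := e01.
elim: k f => [|k IH] f; first by rewrite !noise_form0n.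
rewrite !noise_form_cons /=.
set f1 := fun x => f (cube_cons true x); set f0 := fun x => f (cube_cons false x).
(* Passing to f1 + f0 and f1 - f0 diagonalises the first coordinate. The sum scales the induction
   hypothesis by 1 - e^2; the difference scales it by (1 + e)^2, and the surplus (1 + e)^2 - (1 -
   e)^2 = 4e is absorbed by positivity. *)
have := IH (fun x => 1 * f1 x + 1 * f0 x).
have := IH (fun x => 1 * f1 x + -1 * f0 x).
have := @noise_form_ge0 k e (fun x => 1 * f1 x + -1 * f0 x) e01.
rewrite !noise_form_diag (noise_formC e f0) (noise_formC (- e) f0) !exprS.
have : 0 <= (1 - e) ^+ k by rewrite exprn_ge0 // subr_ge0.
move: (_ ^+ k) (_ ^+ k) => P Q.
do 6!move: (noise_form _ _ _).
move=> a b c a' b' c' P0 h1 h2 h3.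
have i1 := mulr_ge0 P0 h1.
have e2 : 0 <= 1 - e ^+ 2 by rewrite subr_ge0 expr_le1.
have i2 := ler_wpM2l e2 h3.
have i3 := ler_wpM2l (sqr_ge0 (1 + e)) h2.
have i4 := mulr_ge0 e0 i1.
lra.
Qed.

Lemma noise_form_CauchySchwarz k e (f g : cube k -> R) : 0 <= e <= 1 ->
  noise_form e f g ^+ 2 <= noise_form e f f * noise_form e g g.
Proof.
move=> e01.
have H a b : 0 <= a ^+ 2 * noise_form e f f + 2%:R * a * b * noise_form e f g
    + b ^+ 2 * noise_form e g g.
  by rewrite -noise_form_diag noise_form_ge0.
move: H (noise_form_ge0 f e01) (noise_form_ge0 g e01).
set A := noise_form e f f; set B := noise_form e f g; set C := noise_form e g g.
move=> H; rewrite le_eqVlt => /predU1P[A0|A0] C0.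
  (* With A = 0 these weights give the value - (C + 2) B^2, which forces B = 0. *)
  have := H (- (C + 1)) B; rewrite -A0.
  have := mulr_ge0 C0 (sqr_ge0 B); lra.
have := H B (- A).
have -> : B ^+ 2 * A + 2%:R * B * - A * B + (- A) ^+ 2 * C = A * (A * C - B ^+ 2).
  by ring.
by rewrite pmulr_rge0 // subr_ge0.
Qed.
End RealNoiseForm.

(** * Hypercontractivity for indicators *)

Lemma noise_form_indicator_le (R : realType) k (e : R) (P : pred (cube k)) :
  0 < e <= 1 ->
  noise_form e (fun x => (P x)%:R) (fun x => (P x)%:R) <=
    ((1 + e) / 2%:R `^ e) ^+ k * (\sum_x (P x)%:R) `^ (1 + e).
Proof.
move=> e01; have /andP[e0 e1] := e01.
have e01' : 0 <= e <= 1 by rewrite ltW.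
have d0 : 0 < 1 + e by lra.
elim: k P => [|k IH] P.
  rewrite noise_form0n expr0 mul1r.
  rewrite (big_pred1 [ffun=> false]); last first.
    by move=> x; apply/esym/eqP/ffunP => -[].
  by case: (P _); rewrite ?powR1 ?powR0 ?mulr1 ?mulr0 // gt_eqF.
rewrite noise_form_cons /= sum_cube_recl.
set f1 := fun x => (P (cube_cons true x))%:R.
set f0 := fun x => (P (cube_cons false x))%:R.
rewrite (noise_formC e f0 f1).
have H1 : noise_form e f1 f1 <= _ := IH (fun x => P (cube_cons true x)).
have H0 : noise_form e f0 f0 <= _ := IH (fun x => P (cube_cons false x)).
have M := noise_form_CauchySchwarz f1 f0 e01'.
have N1 := noise_form_ge0 f1 e01'; have N0 := noise_form_ge0 f0 e01'.
set K := (1 + e) / _ in H1 H0 *.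
have K0 : 0 < K by rewrite divr_gt0 // powR_gt0.
have Kk : 0 <= K ^+ k by rewrite exprn_ge0 // ltW.
have s1 : 0 <= \sum_x f1 x by apply: sumr_ge0 => x _; rewrite ler0n.
have s0 : 0 <= \sum_x f0 x by apply: sumr_ge0 => x _; rewrite ler0n.
have := two_point_ineq e01 s1 s0; rewrite -/K.
(* Written as squares, the two inductive bounds have a perfect square as product, so Cauchy-Schwarz
   bounds the cross term by their geometric mean [K ^+ k * (A * B)]. *)
have sq (a : R) : a `^ (1 + e) = (a `^ ((1 + e) / 2%:R)) ^+ 2.
  by rewrite -powR_mulrn ?powR_ge0 // -powRrM divfK // pnatr_eq0.
rewrite !sq in H1 H0; rewrite -/f1 -/f0.
have := powR_ge0 (\sum_x f1 x) ((1 + e) / 2%:R).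
have := powR_ge0 (\sum_x f0 x) ((1 + e) / 2%:R).
move: (_ `^ ((1 + e) / 2%:R)) (_ `^ ((1 + e) / 2%:R)) H1 H0 => A B H1 H0 B0 A0 tp.
have D0 : 0 <= K ^+ k * (A * B) by rewrite !mulr_ge0.
have M' : noise_form e f1 f0 <= K ^+ k * (A * B).
  rewrite leNgt; apply/negP => lt.
  have : (K ^+ k * (A * B)) ^+ 2 < noise_form e f1 f0 ^+ 2.
    by rewrite ltr_pXn2r // nnegrE // (le_trans D0) // ltW.
  apply/negP; rewrite -leNgt (le_trans M) //.
  apply: le_trans (ler_pM N1 N0 H1 H0) _.
  by rewrite le_eqVlt; apply/orP; left; apply/eqP; ring.
rewrite exprS.
have i1 := ler_wpM2l Kk tp.
have i2 := ler_wpM2l (ltW e0) M'.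
lra.
Qed.

(** * Conductance of the odd graph *)

Lemma edge_weight_setT (R : realType) (V : finType) (e : rel V)
    (wt : V -> V -> R) (T : {set V}) :
  edge_weight e wt T [set: V] = edge_weight e wt T T + edge_weight e wt T (~: T).
Proof.
rewrite /edge_weight -big_split; apply: eq_bigr => x _ /=.
rewrite (bigID (mem T)) /=; congr (_ + _); apply: eq_bigl => y;
  by rewrite !inE /= andbC.
Qed.

(** Half of e^n - (-e)^n is e^n for odd n and 0 for even n. *)
Lemma odd_edge_weightE (R : realType) k (c : R) (X Y : {set cube k}) :
  let e := noise k c in
  let f x := (x \in X)%:R in let g x := (x \in Y)%:R in
  edge_weight (@odd_adj k) (@odd_weight R k c) X Y =
  (noise_form e f g - noise_form (- e) f g) / 2%:R.
Proof.
move=> e f g; rewrite /edge_weight /noise_form -sumrB mulr_suml big_mkcond.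
apply: eq_bigr => x _; rewrite /f; case: (x \in X); last first.
  by rewrite !big1 ?subrr ?mul0r // => y _; rewrite !mul0r.
rewrite -sumrB mulr_suml big_mkcond; apply: eq_bigr => y _.
rewrite /g /odd_adj /odd_weight -/e exprNn -signr_odd !mul1r.
case: (y \in Y) => /=; last by rewrite !mul0r subrr mul0r.
by case: odd => /=; rewrite ?expr0 ?expr1; field.
Qed.

(** The noise solves (k / c)^e = 2.2, and k / c >= 2.2 makes it at most 1. *)
Lemma noise_spec (R : realType) (k : nat) (c : R) :
  1 <= c -> c <= 10%:R * k%:R / 22%:R ->
  0 < noise k c <= 1 /\ (c / k%:R) `^ noise k c = 10%:R / 22%:R.
Proof.
move=> c1 ck; have c0 : 0 < c by lra.
have k0 : 0 < k%:R :> R by lra.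
have b1 : 1 < 22%:R / 10%:R :> R by lra.
have b0 : 0 < 22%:R / 10%:R :> R by lra.
have L0 : 0 < ln (22%:R / 10%:R) :> R by rewrite ln_gt0.
have kc : 22%:R / 10%:R <= k%:R / c by rewrite ler_pdivlMr //; lra.
have kc0 : 0 < k%:R / c by rewrite divr_gt0.
have L1 : ln (22%:R / 10%:R) <= ln (k%:R / c) by rewrite ler_ln // posrE.
have L2 := lt_le_trans L0 L1.
have E : noise k c = ln (22%:R / 10%:R) / ln (k%:R / c).
  by rewrite /noise /logb div1r invf_div.
rewrite E; split.
  by rewrite divr_gt0 //= ler_pdivrMr // mul1r.
have -> : c / k%:R = (k%:R / c)^-1 by rewrite invf_div.
rewrite /powR invr_eq0 (gt_eqF kc0) lnV ?posrE // mulrN divfK ?gt_eqF //.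
by rewrite -lnV ?posrE // lnK ?posrE ?invr_gt0 // invf_div.
Qed.

Theorem theorem14 (R : realType) (k : nat) (c : R)
    (c_ge1 : 1 <= c) (c_le : c <= 10%:R * k%:R / 22%:R)
    (T : {set cube k}) (T_neq0 : T != set0)
    (T_small : #|T|%:R < c / k%:R * #|[set: cube k]|%:R) :
  1 / 2%:R <= odd_conductance c T.
Proof.
have k0 : 0 < k%:R :> R by lra.
have [e01 epow] := noise_spec c_ge1 c_le.
rewrite /odd_conductance /conductance.
have WT := edge_weight_setT (@odd_adj k) (@odd_weight R k c) T.
have EV := odd_edge_weightE c T [set: cube k].
have ET := odd_edge_weightE c T T.
move: EV ET; cbv zeta.
set e := noise k c in e01 epow *; have /andP[e0 e1] := e01.
have e01' : 0 <= e <= 1 by rewrite ltW.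
set f := fun x => (x \in T)%:R : R.
have -> : (fun x : cube k => (x \in [set: cube k])%:R : R) = fun=> 1.
  by apply: funext => x; rewrite inE.
have fE : \sum_x f x = #|T|%:R.
  rewrite -sum1_card natr_sum [RHS]big_mkcond; apply: eq_bigr => x _.
  by rewrite /f; case: (x \in T).
rewrite !noise_form_const1r fE => EV ET.
have T0 : 0 < #|T|%:R :> R by rewrite ltr0n card_gt0.
have C := noise_formN_ge f e01'.
have H : noise_form e f f <=
    ((1 + e) / 2%:R `^ e) ^+ k * (\sum_x f x) `^ (1 + e).
  exact: (noise_form_indicator_le (mem T) e01).
rewrite fE in H.
have {}H : noise_form e f f <= (1 + e) ^+ k * #|T|%:R * (10%:R / 22%:R).
  apply: le_trans H _.
  have p0 : 0 < 2%:R `^ e :> R by rewrite powR_gt0.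
  rewrite powRD ?(gt_eqF T0) ?implybT // powRr1 ?(ltW T0) // expr_div_n.
  rewrite -[leLHS]mulrA -[leRHS]mulrA ler_wpM2l ?exprn_ge0 ?addr_ge0 ?(ltW e0) //.
  rewrite [X in X <= _]mulrCA ler_wpM2l ?(ltW T0) //.
  (* Once (1 + e)^k and one factor |T| are cancelled, what remains is |T|^e <= (c / k)^e (2^k)^e,
     the e-th power of the size hypothesis. *)
  rewrite mulrC ler_pdivrMr ?exprn_gt0 // -epow -powR_mulrn ?powR_ge0 //.
  rewrite powRAC powR_mulrn // -powRM //.
  - apply: ge0_ler_powR; rewrite ?nnegrE //; first exact: ltW.
    + by rewrite mulr_ge0 ?exprn_ge0 // divr_ge0 //; lra.
    + apply: ltW; apply: lt_le_trans T_small _.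
      by rewrite cardsT card_ffun card_bool card_ord natrX.
  - by rewrite divr_ge0 //; lra.
  - by rewrite exprn_ge0.
set d := ((1 + e) ^+ k * #|T|%:R - (1 - e) ^+ k * #|T|%:R) / 2%:R in EV.
have kn0 : k != 0%N by move: k0; rewrite ltr0n lt0n.
have Q0 : 0 <= (1 - e) ^+ k by rewrite exprn_ge0 // subr_ge0.
have lt : (1 - e) ^+ k < (1 + e) ^+ k.
  by rewrite ltr_pXn2r ?lt0n // ?nnegrE; lra.
have P0 : 0 < (1 + e) ^+ k by apply: le_lt_trans lt.
have WV : 0 < edge_weight (@odd_adj k) (@odd_weight R k c) T [set: cube k].
  by rewrite EV /d -mulrBl !mulr_gt0 ?subr_gt0 ?invr_gt0.
rewrite ler_pdivlMr //.
(* Since w(T, V) = w(T, T) + w(T, V \ T), it is enough that at most half of the weight stays inside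
   T. *)
suff : edge_weight (@odd_adj k) (@odd_weight R k c) T T <=
  (1 / 2%:R) * edge_weight (@odd_adj k) (@odd_weight R k c) T [set: cube k] by lra.
rewrite ET EV /d.
move: C H Q0 lt P0.
move: (noise_form e f f) (noise_form (- e) f f) ((1 - e) ^+ k) ((1 + e) ^+ k).
move=> X Y Q P C H Q0 lt P0.
(* Multiplying by P lets [C] replace P (X - Y) by (P - Q) X; then [H] applies, and 10/22 <= 1/2
   closes the gap. *)
rewrite -(ler_pM2l P0).
have i1 : (P - Q) * X <= (P - Q) * (P * #|T|%:R * (10%:R / 22%:R)).
  by rewrite ler_wpM2l // subr_ge0 ltW.
have i2 : 0 <= (P - Q) * (P * #|T|%:R).
  by rewrite !mulr_ge0 ?subr_ge0 ?ltW.
lra.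
Qed.
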